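(* Let $X$ be a topological space in which every open set is a union of countably many clopen sets. The following are equivalent: (1) $X$ has the bounded-ideal convergence property; (2) $C_p(X)$ is an $\alpha_1$ space; (3) every Borel image of $X$ in $\mathbb{N}^{\mathbb{N}}$ is bounded.
   Context: For an ideal $\mathcal{I}$ on a countable set $D$ (containing singletons, closed under subsets and finite unions), $\mathcal{I}^*=\{D\setminus A:A\in\mathcal{I}\}$. A family $\{f_d\}_{d\in D}$ of real functions on $X$ $\mathcal{I}$-converges to $0$ if for each $x\in X$ and $\epsilon>0$, $\{d:|f_d(x)|<\epsilon\}\in\mathcal{I}^*$. $X$ has the $\mathcal{I}$-convergence property if for each family $\{f_d\}_{d\in D}$ of continuous real-valued functions on $X$ that $\mathcal{I}$-converges to $0$ there is $A\in\mathcal{I}^*$ with $\{f_d\}_{d\in A}$ converging pointwise to $0$ (for each $x$, $\epsilon>0$, only finitely many $d\in A$ have $|f_d(x)|\ge\epsilon$). With $D=\mathbb{N}\times\mathbb{N}$ and $A_h=\{(n,m):m\le h(n)\}$ for $h\in\mathbb{N}^{\mathbb{N}}$, the bounded-ideal is $\mathcal{I}_b=\{B\subseteq\mathbb{N}\times\mathbb{N}:\exists h\in\mathbb{N}^{\mathbb{N}},\ B\subseteq A_h\}$; the bounded-ideal convergence property is the $\mathcal{I}_b$-convergence property. $C_p(X)$: continuous real functions with pointwise topology. A countable set converges to $y$ if some (every) bijective enumeration does; $Y$ is $\alpha_1$ if for each $y$ and countably infinite sets $A_n$ converging to $y$ there are cofinite $B_n\subseteq A_n$ with $\bigcup_nB_n$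 converging to $y$. $Y\subseteq\mathbb{N}^{\mathbb{N}}$ is bounded if some $g$ satisfies $f(n)\le g(n)$ for all but finitely many $n$, for each $f\in Y$; a Borel image is $\Psi[X]$ for Borel measurable $\Psi$. *)

(* Defs.v *)
From Stdlib Require Import Reals List.
Open Scope R_scope.

Definition is_topology {X : Type} (op : (X -> Prop) -> Prop) : Prop :=
  op (fun _ => True) /\ op (fun _ => False) /\
  (forall U V, op U -> op V -> op (fun x => U x /\ V x)) /\
  (forall F : (X -> Prop) -> Prop, (forall U, F U -> op U) ->
     op (fun x => exists U, F U /\ U x)).

Definition clopen {X : Type} (op : (X -> Prop) -> Prop) (A : X -> Prop) : Prop :=
  op A /\ op (fun x => ~ A x).

(* every open set is a union of countably many clopen sets
   (countable = indexed by nat; empty/finite unions allowed via repetition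
    or the empty set, which is clopen) *)
Definition open_countable_union_clopen {X : Type} (op : (X -> Prop) -> Prop) : Prop :=
  forall U, op U -> exists C : nat -> X -> Prop,
    (forall n, clopen op (C n)) /\ (forall x, U x <-> exists n, C n x).

Definition continuous_R {X : Type} (op : (X -> Prop) -> Prop) (f : X -> R) : Prop :=
  forall V : R -> Prop, open_set V -> op (fun x => V (f x)).

Definition finite_set {D : Type} (P : D -> Prop) : Prop :=
  exists l : list D, forall d, P d -> In d l.

Definition dual_filter {D : Type} (I : (D -> Prop) -> Prop) (A : D -> Prop) : Prop :=
  I (fun d => ~ A d).

Definition I_converges_to_0 {X D : Type} (I : (D -> Prop) -> Prop)
  (f : D -> X -> R) : Prop :=
  forall x eps, eps > 0 -> dual_filter I (fun d => Rabs (f d x) < eps).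

Definition pointwise_conv_0_on {X D : Type} (A : D -> Prop) (f : D -> X -> R) : Prop :=
  forall x eps, eps > 0 -> finite_set (fun d => A d /\ Rabs (f d x) >= eps).

Definition I_convergence_property {X D : Type} (op : (X -> Prop) -> Prop)
  (I : (D -> Prop) -> Prop) : Prop :=
  forall f : D -> X -> R, (forall d, continuous_R op (f d)) ->
    I_converges_to_0 I f ->
    exists A, dual_filter I A /\ pointwise_conv_0_on A f.

Definition bounded_ideal (B : nat * nat -> Prop) : Prop :=
  exists h : nat -> nat, forall n m, B (n, m) -> (m <= h n)%nat.

Definition bounded_ideal_convergence_property {X : Type}
  (op : (X -> Prop) -> Prop) : Prop :=
  I_convergence_property op bounded_ideal.

(* convergence of a sequence in C_p(X) (topology of pointwise convergence,
   basic neighbourhoods given by finitely many points and eps > 0) *)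
Definition Cp_seq_converges {X : Type} (e : nat -> X -> R) (y : X -> R) : Prop :=
  forall (xs : list X) (eps : R), eps > 0 ->
    exists N, forall k, (k >= N)%nat -> forall x, In x xs -> Rabs (e k x - y x) < eps.

Definition Cp_set_converges {X : Type} (A : (X -> R) -> Prop) (y : X -> R) : Prop :=
  exists e : nat -> X -> R,
    (forall k, A (e k)) /\
    (forall i j, e i = e j -> i = j) /\
    (forall g, A g -> exists k, e k = g) /\
    Cp_seq_converges e y.

Definition countably_infinite {T : Type} (A : T -> Prop) : Prop :=
  exists e : nat -> T, (forall k, A (e k)) /\ (forall i j, e i = e j -> i = j) /\
    (forall g, A g -> exists k, e k = g).

Definition Cp_alpha1 {X : Type} (op : (X -> Prop) -> Prop) : Prop :=
  forall (y : X -> R) (A : nat -> (X -> R) -> Prop),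
    continuous_R op y ->
    (forall n g, A n g -> continuous_R op g) ->
    (forall n, countably_infinite (A n)) ->
    (forall n, Cp_set_converges (A n) y) ->
    exists B : nat -> (X -> R) -> Prop,
      (forall n g, B n g -> A n g) /\
      (forall n, finite_set (fun g => A n g /\ ~ B n g)) /\
      Cp_set_converges (fun g => exists n, B n g) y.

Definition baire_open (U : (nat -> nat) -> Prop) : Prop :=
  forall f, U f -> exists n, forall g, (forall i, (i < n)%nat -> g i = f i) -> U g.

Inductive borel {X : Type} (op : (X -> Prop) -> Prop) : (X -> Prop) -> Prop :=
| borel_open : forall U, op U -> borel op U
| borel_compl : forall A, borel op A -> borel op (fun x => ~ A x)
| borel_union : forall A : nat -> X -> Prop, (forall n, borel op (A n)) ->
    borel op (fun x => exists n, A n x).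

Definition borel_measurable {X : Type} (op : (X -> Prop) -> Prop)
  (Psi : X -> nat -> nat) : Prop :=
  forall U, baire_open U -> borel op (fun x => U (Psi x)).

Definition bounded_set (Y : (nat -> nat) -> Prop) : Prop :=
  exists g : nat -> nat, forall f, Y f -> exists N, forall n, (n >= N)%nat -> (f n <= g n)%nat.

Definition borel_images_bounded {X : Type} (op : (X -> Prop) -> Prop) : Prop :=
  forall Psi : X -> nat -> nat, borel_measurable op Psi ->
    bounded_set (fun f => exists x, Psi x = f).

(* Main.v *)
Require Import Defs.
From Stdlib Require Import Reals List.
From Stdlib Require Import Lra Lia Arith Cantor.
From Stdlib Require Import Classical ClassicalEpsilon.
From Stdlib Require Import FunctionalExtensionality PropExtensionality.

(** The implication from (2) to (3) rests on the selection principle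
    [clopen_selection]: if, for each [n], the clopen sets [C n m] eventually
    contain each point, then some [h] makes [x] belong to all [C n m] with
    [m >= h n], for all but finitely many [n].  It follows from alpha_1 applied to the
    indicators of the complements of the [C n m].  Applied to the sets on which
    [D n m] and [D n (S m)] agree, it gives a diagonal sequence, so that the
    pointwise limits of sequences of clopen sets are closed under countable
    unions and every Borel set is such a limit.  Hence the sets
    [Psi x n <= k], doubly indexed by [n] and [k], may be replaced by clopen
    sets with only finitely many errors at each point, and a second use of the
    principle bounds the image of [Psi].  For (3) to (1), one bounds
    the Borel map sending [x] and [n] to the least [k] such that
    [|f (n, m) x| < 1 / (n + 1)] for all [m >= k]. *)

(** * Choice, least elements and injective enumerations *)

Lemma pred_ext {T : Type} (A B : T -> Prop) : (forall x, A x <-> B x) -> A = B.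
Proof.
  intros H. apply functional_extensionality; intros x.
  apply propositional_extensionality, H.
Qed.

Lemma fun_choice {A B : Type} (P : A -> B -> Prop) :
  (forall a, exists b, P a b) -> exists f, forall a, P a (f a).
Proof.
  intros H.
  exists (fun a => proj1_sig (constructive_indefinite_description _ (H a))).
  intros a. exact (proj2_sig (constructive_indefinite_description _ (H a))).
Qed.

Lemma least_nat (P : nat -> Prop) :
  (exists n, P n) -> exists n, P n /\ forall k, P k -> (n <= k)%nat.
Proof.
  intros H.
  destruct (dec_inh_nat_subset_has_unique_least_element P
              (fun n => classic (P n)) H) as [n [Hn _]].
  exists n; exact Hn.
Qed.

(** Each entry of the list covering [P] is hit at most once by [f]. This turns finite exceptional
    sets into thresholds along an enumeration. *)
Lemma injective_eventually_avoids {D : Type} (P : D -> Prop) (f : nat -> D) :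
  finite_set P -> (forall i j, f i = f j -> i = j) ->
  exists N, forall k, (k >= N)%nat -> ~ P (f k).
Proof.
  intros [l Hl] Hf.
  assert (H : exists N, forall k, (k >= N)%nat -> ~ In (f k) l).
  { clear Hl. induction l as [|a l [N IH]].
    - exists 0%nat. intros k _ [].
    - destruct (classic (exists k, f k = a)) as [[k0 Hk0]|Hno].
      + exists (max N (S k0)). intros k Hk [Ha|Hin].
        * assert (k0 = k) by (apply Hf; congruence). lia.
        * apply (IH k); [lia|exact Hin].
      + exists N. intros k Hk [Ha|Hin].
        * apply Hno. exists k. now symmetry.
        * now apply (IH k). }
  destruct H as [N HN]. exists N. intros k Hk HP.
  apply (HN k Hk), Hl, HP.
Qed.

Lemma infinite_nat_enum (P : nat -> Prop) :
  (forall k, exists j, (k <= j)%nat /\ P j) ->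
  exists phi : nat -> nat, (forall i, P (phi i)) /\
    (forall i j, phi i = phi j -> i = j) /\
    (forall j, P j -> exists i, phi i = j).
Proof.
  intros HP.
  assert (Hn : forall k, exists j, ((k <= j)%nat /\ P j) /\
                 forall i, (k <= i)%nat /\ P i -> (j <= i)%nat).
  { intros k. apply least_nat, HP. }
  destruct (fun_choice _ Hn) as [nxt Hnxt].
  set (phi := fix phi i := match i with O => nxt 0%nat | S i => nxt (S (phi i)) end).
  assert (Hstep : forall i, (phi i < phi (S i))%nat).
  { intros i. destruct (Hnxt (S (phi i))) as [[H _] _]. exact H. }
  assert (Hmono : forall i j, (i < j)%nat -> (phi i < phi j)%nat).
  { intros i j H. induction H as [|j _ IH].
    - apply Hstep.
    - specialize (Hstep j). lia. }
  exists phi. repeat split.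
  - intros [|i]; apply Hnxt.
  - intros i j H. destruct (Nat.lt_trichotomy i j) as [L|[L|L]]; trivial;
      apply Hmono in L; lia.
  - intros j Hj.
    assert (Hge : forall i, (i <= phi i)%nat).
    { induction i as [|i IH]; [lia|]. specialize (Hstep i). lia. }
    (* At the least such [i], the point [j] lies beyond the previous value of [phi], so the choice
       of [phi i] as the next element of [P] forces [phi i <= j]. *)
    destruct (least_nat (fun i => (j <= phi i)%nat)) as [i [Hi Hmin]].
    { exists j. apply Hge. }
    exists i. apply Nat.le_antisymm; [|exact Hi].
    destruct i as [|i].
    + apply (Hnxt 0%nat). split; [lia|exact Hj].
    + apply (Hnxt (S (phi i))). split; [|exact Hj].
      destruct (le_lt_dec j (phi i)) as [L|L]; [|exact L].
      specialize (Hmin i L). lia.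
Qed.

(** Keeping only the first index at which each value of [u] occurs removes repetitions. The
    injective [s] guarantees infinitely many values. *)
Lemma infinite_range_enum {T : Type} (u s : nat -> T) :
  (forall i j, s i = s j -> i = j) -> (forall i, exists k, u k = s i) ->
  exists phi : nat -> nat, (forall i j, phi i = phi j -> i = j) /\
    (forall i j, u (phi i) = u (phi j) -> i = j) /\
    (forall k, exists i, u (phi i) = u k).
Proof.
  intros Hs Hus.
  set (P := fun k => forall j, u j = u k -> (k <= j)%nat).
  assert (Hfirst : forall k, exists j, P j /\ u j = u k).
  { intros k. destruct (least_nat (fun j => u j = u k)) as [j [Hj Hmin]].
    { now exists k. }
    exists j. split; [|exact Hj]. intros i Hi. apply Hmin. congruence. }
  destruct (infinite_nat_enum P) as [phi [HP [Hinj Hsurj]]].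
  { intros k.
    (* Finitely many values occur before index [k], so some value of [s] is none of them and first
       occurs at or after [k]. *)
    destruct (injective_eventually_avoids
                (fun t => exists i, (i < k)%nat /\ t = u i) s) as [N HN]; trivial.
    { exists (map u (seq 0 k)). intros t [i [Hi ->]].
      apply in_map, in_seq. lia. }
    destruct (Hus N) as [k0 Hk0]. destruct (Hfirst k0) as [j [Hj Hju]].
    exists j. split; [|exact Hj].
    destruct (le_lt_dec k j) as [L|L]; [exact L|].
    destruct (HN N); [lia|]. exists j. split; [exact L|congruence]. }
  exists phi. repeat split; trivial.
  - intros i j H. apply Hinj, Nat.le_antisymm; apply HP; congruence.
  - intros k. destruct (Hfirst k) as [j [Hj Hju]].
    destruct (Hsurj j Hj) as [i Hi]. exists i. congruence.
Qed.

(** * Pointwise convergence of sequences of functions *)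

Lemma Cp_seq_converges_pointwise {X : Type} (e : nat -> X -> R) (y : X -> R) :
  (forall x eps, eps > 0 ->
     exists N, forall k, (k >= N)%nat -> Rabs (e k x - y x) < eps) ->
  Cp_seq_converges e y.
Proof.
  intros H xs eps He. induction xs as [|a xs [N IH]].
  - exists 0%nat. intros k _ x [].
  - destruct (H a eps He) as [N' HN']. exists (max N N').
    intros k Hk x [Ha|Hx].
    + rewrite <- Ha. apply HN'. lia.
    + apply IH; [lia|exact Hx].
Qed.

Lemma Cp_seq_converges_at {X : Type} (e : nat -> X -> R) (y : X -> R) x eps :
  Cp_seq_converges e y -> eps > 0 ->
  exists N, forall k, (k >= N)%nat -> Rabs (e k x - y x) < eps.
Proof.
  intros H He. destruct (H (x :: nil) eps He) as [N HN].
  exists N. intros k Hk. apply HN; [exact Hk|now left].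
Qed.

Lemma open_set_abs_lt e : 0 < e -> open_set (fun r => Rabs r < e).
Proof.
  intros He. replace (fun r => Rabs r < e) with (disc 0 (mkposreal e He)).
  - apply disc_P1.
  - apply pred_ext; intros r. unfold disc. now rewrite Rminus_0_r.
Qed.

Section Topology.

Variables (X : Type) (op : (X -> Prop) -> Prop).
Hypothesis Htop : is_topology op.

(** * Open and clopen sets *)

Lemma open_const (P : Prop) : op (fun _ => P).
Proof.
  destruct (classic P) as [H|H].
  - replace (fun _ : X => P) with (fun _ : X => True); [apply Htop|].
    apply pred_ext; tauto.
  - replace (fun _ : X => P) with (fun _ : X => False); [apply Htop|].
    apply pred_ext; tauto.
Qed.

Lemma open_inter U V : op U -> op V -> op (fun x => U x /\ V x).
Proof. apply Htop. Qed.

Lemma open_union U V : op U -> op V -> op (fun x => U x \/ V x).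
Proof.
  intros HU HV. destruct Htop as [_ [_ [_ Hun]]].
  replace (fun x => U x \/ V x) with (fun x => exists W, (W = U \/ W = V) /\ W x).
  - apply Hun. intros W [HW|HW]; now rewrite HW.
  - apply pred_ext; intros x. split.
    + intros [W [[HW|HW] H]]; rewrite HW in H; auto.
    + intros [H|H]; [exists U|exists V]; auto.
Qed.

Lemma open_of_neighbourhoods U :
  (forall x, U x -> exists W, op W /\ W x /\ forall z, W z -> U z) -> op U.
Proof.
  intros H. destruct Htop as [_ [_ [_ Hun]]].
  replace U with (fun x => exists W, (op W /\ forall z, W z -> U z) /\ W x).
  - apply Hun. tauto.
  - apply pred_ext; intros x. split.
    + intros [W [[_ HW] Hx]]. auto.
    + intros Hx. destruct (H x Hx) as [W HW]. exists W. tauto.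
Qed.

Lemma clopen_compl A : clopen op A -> clopen op (fun x => ~ A x).
Proof.
  intros [H1 H2]. split; trivial.
  replace (fun x => ~ ~ A x) with A; trivial.
  apply pred_ext; intros x; split; [tauto|apply NNPP].
Qed.

Lemma clopen_union A B : clopen op A -> clopen op B -> clopen op (fun x => A x \/ B x).
Proof.
  intros [HA HA'] [HB HB']. split.
  - now apply open_union.
  - replace (fun x => ~ (A x \/ B x)) with (fun x => ~ A x /\ ~ B x).
    + now apply open_inter.
    + apply pred_ext; tauto.
Qed.

Lemma clopen_iff A B : clopen op A -> clopen op B -> clopen op (fun x => A x <-> B x).
Proof.
  intros HA HB.
  replace (fun x => A x <-> B x)
    with (fun x => ~ (A x \/ B x) \/ ~ (~ A x \/ ~ B x)).
  - apply clopen_union; apply clopen_compl, clopen_union; trivial;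
      now apply clopen_compl.
  - apply pred_ext; intros x; tauto.
Qed.

(** * Continuous real functions *)

Definition indicator (A : X -> Prop) (x : X) : R :=
  if excluded_middle_informative (A x) then 1 else 0.

Lemma continuous_indicator_plus A c :
  clopen op A -> continuous_R op (fun x => indicator A x + c).
Proof.
  intros [HA HA'] V _.
  replace (fun x => V (indicator A x + c))
    with (fun x => (A x /\ V (1 + c)) \/ (~ A x /\ V (0 + c))).
  - apply open_union; apply open_inter; trivial; apply open_const.
  - apply pred_ext; intros x. unfold indicator.
    destruct (excluded_middle_informative (A x)); tauto.
Qed.

Lemma continuous_minus f g :
  continuous_R op f -> continuous_R op g -> continuous_R op (fun x => f x - g x).
Proof.
  intros Hf Hg V HV. apply open_of_neighbourhoods. intros x Hx.
  destruct (HV _ Hx) as [d Hd].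
  assert (Hd2 : 0 < d / 2) by (destruct d as [d Hd0]; simpl; lra).
  set (d2 := mkposreal _ Hd2).
  exists (fun z => disc (f x) d2 (f z) /\ disc (g x) d2 (g z)).
  split; [|split].
  - apply open_inter; [apply Hf|apply Hg]; apply disc_P1.
  - unfold disc. rewrite !Rminus_diag, Rabs_R0. simpl. lra.
  - intros z [H1 H2]. apply Hd. unfold disc in *. simpl in *.
    apply Rabs_def2 in H1, H2. apply Rabs_def1; lra.
Qed.

(** * Borel sets and Borel maps into the Baire space *)

Lemma borel_iff A B : (forall x, A x <-> B x) -> borel op A -> borel op B.
Proof. intros H HA. now rewrite <- (pred_ext A B H). Qed.

Lemma borel_const (P : Prop) : borel op (fun _ => P).
Proof. apply borel_open, open_const. Qed.

Lemma borel_inter_nat (A : nat -> X -> Prop) :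
  (forall n, borel op (A n)) -> borel op (fun x => forall n, A n x).
Proof.
  intros H. apply borel_iff with (fun x => ~ exists n, ~ A n x).
  - intros x. split.
    + intros Hx n. apply NNPP. eauto.
    + intros Hx [n Hn]. auto.
  - apply borel_compl, borel_union. intros n. apply borel_compl, H.
Qed.

Lemma borel_inter A B : borel op A -> borel op B -> borel op (fun x => A x /\ B x).
Proof.
  intros HA HB.
  apply borel_iff with (fun x => forall n : nat, match n with O => A x | _ => B x end).
  - intros x. split.
    + intros H. split; [exact (H 0%nat)|exact (H 1%nat)].
    + intros [H1 H2] [|n]; trivial.
  - apply borel_inter_nat. intros [|n]; trivial.
Qed.

Lemma borel_measurable_coordinates (Psi : X -> nat -> nat) :
  (forall n k, borel op (fun x => (Psi x n <= k)%nat)) -> borel_measurable op Psi.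
Proof.
  intros Hle.
  assert (Heq : forall n k, borel op (fun x => Psi x n = k)).
  { intros n [|k].
    - apply borel_iff with (fun x => (Psi x n <= 0)%nat); trivial. intros x; lia.
    - apply borel_iff with (fun x => (Psi x n <= S k)%nat /\ ~ (Psi x n <= k)%nat).
      + intros x; lia.
      + apply borel_inter; [|apply borel_compl]; apply Hle. }
  (* [W] depends only on the first [n] coordinates. The induction splits over the countably many
     values [k] of the last one and substitutes [k] for it by [upd]. *)
  assert (Hcyl : forall n (W : (nat -> nat) -> Prop),
    (forall f g, (forall i, (i < n)%nat -> g i = f i) -> W f -> W g) ->
    borel op (fun x => W (Psi x))).
  { induction n as [|n IH]; intros W HW.
    - apply borel_iff with (fun _ => W (fun _ => 0%nat)).
      + intros x. split; apply HW; intros; lia.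
      + apply borel_const.
    - set (upd := fun (f : nat -> nat) k i => if Nat.eq_dec i n then k else f i).
      apply borel_iff with (fun x => exists k, Psi x n = k /\ W (upd (Psi x) k)).
      + intros x. split.
        * intros [k [Hk H]]. revert H. apply HW. intros i _. unfold upd.
          destruct (Nat.eq_dec i n); congruence.
        * intros H. exists (Psi x n). split; trivial. revert H. apply HW.
          intros i _. unfold upd. destruct (Nat.eq_dec i n); congruence.
      + apply borel_union. intros k. apply borel_inter; trivial.
        apply (IH (fun f => W (upd f k))). intros f g Hfg. apply HW.
        intros i Hi. unfold upd. destruct (Nat.eq_dec i n); trivial.
        apply Hfg. lia. }
  intros U HU.
  (* [U] is the union over [n] of the sets of points whose cylinder of length [n] lies in [U]. *)
  apply borel_iff with
    (fun x => exists n, forall g, (forall i, (i < n)%nat -> g i = Psi x i) -> U g).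
  - intros x. split.
    + intros [n Hn]. apply Hn. trivial.
    + apply HU.
  - apply borel_union. intros n.
    apply (Hcyl n (fun f => forall g, (forall i, (i < n)%nat -> g i = f i) -> U g)).
    intros f g Hfg H g' Hg'. apply H. intros i Hi.
    rewrite Hg', Hfg; trivial.
Qed.

(** * From bounded Borel images to the convergence property *)

Lemma bounded_images_bounded_ideal_convergence :
  borel_images_bounded op -> bounded_ideal_convergence_property op.
Proof.
  intros Hb f Hf Hconv.
  assert (Hpos : forall n, / INR (S n) > 0).
  { intros n. apply Rinv_0_lt_compat, lt_0_INR. lia. }
  set (P := fun x n k => forall m, (m >= k)%nat -> Rabs (f (n, m) x) < / INR (S n)).
  assert (Hex : forall p : X * nat, exists k, P (fst p) (snd p) k /\
                  forall j, P (fst p) (snd p) j -> (k <= j)%nat).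
  { intros [x n]. apply (least_nat (P x n)).
    destruct (Hconv x _ (Hpos n)) as [h Hh].
    exists (S (h n)). intros m Hm. apply NNPP. intros H.
    apply Hh in H. lia. }
  destruct (fun_choice _ Hex) as [psi Hpsi].
  destruct (Hb (fun x n => psi (x, n))) as [g Hg].
  { apply borel_measurable_coordinates. intros n k.
    (* Minimality of [psi] turns [psi (x, n) <= k] into a condition on all [m >= k], hence into a
       countable intersection of open sets. *)
    apply borel_iff with
      (fun x => forall j, Rabs (f (n, (k + j)%nat) x) < / INR (S n)).
    - intros x. destruct (Hpsi (x, n)) as [H1 H2]. split.
      + intros H. apply H2. intros m Hm. simpl fst; simpl snd.
        replace m with (k + (m - k))%nat by lia. apply H.
      + intros H j. apply H1. lia.
    - apply borel_inter_nat. intros j. apply borel_open.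
      apply (Hf (n, (k + j)%nat) (fun r => Rabs r < / INR (S n))).
      apply open_set_abs_lt, Hpos. }
  exists (fun d => (g (fst d) <= snd d)%nat). split.
  - exists g. intros n m H. simpl in H. lia.
  - intros x eps He.
    destruct (Hg _ (ex_intro _ x eq_refl)) as [N HN].
    destruct (archimed_cor1 eps He) as [N' [HN' HN'0]].
    destruct (Hconv x eps He) as [h Hh].
    (* In columns [n >= max N N'] the kept values are below [1 / (n + 1)], hence below [eps]. In
       each of the finitely many earlier columns, ideal convergence bounds the bad [m] by [h n]. *)
    exists (flat_map (fun n => map (pair n) (seq 0 (S (h n)))) (seq 0 (max N N'))).
    intros [n m] [HA Hge]. simpl in HA.
    apply in_flat_map. exists n. split.
    + apply in_seq. split; [lia|]. apply Nat.nle_gt. intros Hn.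
      assert (Hlt : Rabs (f (n, m) x) < / INR (S n)).
      { apply (Hpsi (x, n)). simpl. specialize (HN n). lia. }
      assert (/ INR (S n) <= / INR N').
      { apply Rinv_le_contravar; [now apply lt_0_INR|apply le_INR; lia]. }
      lra.
    + apply in_map, in_seq. split; [lia|].
      assert (m <= h n)%nat by (apply Hh; lra). lia.
Qed.

(** * From the convergence property to alpha_1 *)

(** With [A n] enumerated as column [n], a set in the dual filter omits only an initial segment of
    each column, so the remaining tails serve as the cofinite sets [B n]. *)
Lemma bounded_ideal_convergence_alpha1 :
  bounded_ideal_convergence_property op -> Cp_alpha1 op.
Proof.
  intros HI y A Hy HA _ Hconv.
  destruct (fun_choice _ Hconv) as [e He].
  destruct (HI (fun d x => e (fst d) (snd d) x - y x)) as [S0 [[h Hh] HS]].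
  { intros [n m]. apply continuous_minus; trivial. apply (HA n), He. }
  { intros x eps Heps.
    assert (Hk : forall n, exists N, forall k, (k >= N)%nat ->
                   Rabs (e n k x - y x) < eps).
    { intros n. apply Cp_seq_converges_at; trivial. apply He. }
    destruct (fun_choice _ Hk) as [h Hh]. exists h. intros n m H.
    destruct (le_lt_dec m (h n)) as [L|L]; trivial.
    destruct H. apply (Hh n m). lia. }
  (* [d] enumerates without repetition the pairs strictly above the graph of [h], all of which lie
     in [S0]. *)
  set (d := fun k => (fst (of_nat k), (S (h (fst (of_nat k))) + snd (of_nat k))%nat)).
  assert (Hd : forall n m, (m > h n)%nat -> exists k, d k = (n, m)).
  { intros n m H. exists (to_nat (n, m - S (h n)))%nat. unfold d.
    rewrite cancel_of_to. simpl. f_equal. lia. }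
  assert (Hdinj : forall i j, d i = d j -> i = j).
  { intros i j H. injection H as H1 H2.
    rewrite <- (cancel_to_of i), <- (cancel_to_of j).
    destruct (of_nat i) as [a b], (of_nat j) as [a' b'].
    cbn [fst snd] in *. subst a'. replace b' with b by lia. trivial. }
  (* The sets [A n] may overlap, so distinct pairs can give the same function. The tail of column 0
     already supplies infinitely many functions. *)
  destruct (infinite_range_enum (fun k => e (fst (d k)) (snd (d k)))
              (fun i => e 0%nat (S (h 0%nat) + i)%nat)) as [phi [Hphi [Hinj Hsurj]]].
  { intros i j H. destruct (He 0%nat) as [_ [Hi _]]. apply Hi in H. lia. }
  { intros i. destruct (Hd 0%nat (S (h 0%nat) + i)%nat) as [k Hk]; [lia|].
    exists k. now rewrite Hk. }
  exists (fun n g => exists m, (m > h n)%nat /\ g = e n m). repeat split.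
  - intros n g [m [_ ->]]. apply He.
  - intros n. exists (map (e n) (seq 0 (S (h n)))). intros g [Hg HnB].
    apply He in Hg. destruct Hg as [m <-].
    apply in_map, in_seq. split; [lia|].
    apply Nat.nle_gt. intros Hm. apply HnB. exists m. split; [lia|trivial].
  - exists (fun i => e (fst (d (phi i))) (snd (d (phi i)))). repeat split.
    + intros k. exists (fst (d (phi k))), (snd (d (phi k))). split; trivial.
      unfold d. simpl. lia.
    + exact Hinj.
    + intros g [n [m [Hm ->]]]. destruct (Hd n m Hm) as [k Hk].
      destruct (Hsurj k) as [i Hi]. exists i. rewrite Hi, Hk. trivial.
    + apply Cp_seq_converges_pointwise. intros x eps Heps.
      destruct (injective_eventually_avoids _ (fun i => d (phi i)) (HS x eps Heps))
        as [N HN].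
      { intros i j H. auto. }
      exists N. intros k Hk. apply Rnot_ge_lt. intros Hge.
      apply (HN k Hk). split; trivial. apply NNPP. intros Hno.
      apply Hh in Hno. lia.
Qed.

(** * The selection principle for clopen sets *)

Lemma clopen_selection (C : nat -> nat -> X -> Prop) :
  Cp_alpha1 op -> (forall n m, clopen op (C n m)) ->
  (forall n x, exists k, forall m, (m >= k)%nat -> C n m x) ->
  exists h : nat -> nat, forall x, exists N, forall n m,
    (n >= N)%nat -> (m >= h n)%nat -> C n m x.
Proof.
  intros Ha HC Hev.
  (* A point [x0] is needed to tell functions apart by their values; on the empty space any [h] will
     do. *)
  destruct (classic (exists x : X, True)) as [[x0 _]|Hempty].
  2: { exists (fun _ => 0%nat). intros x. destruct Hempty. now exists x. }
  set (c := fun k => / INR (k + 2)).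
  assert (Hc : forall k, 0 < c k < 1).
  { intros k. unfold c. rewrite plus_INR. assert (H := pos_INR k). simpl. split.
    - apply Rinv_0_lt_compat. lra.
    - rewrite <- Rinv_1. apply Rinv_lt_contravar; lra. }
  assert (Hcinj : forall i j, c i = c j -> i = j).
  { intros i j H. apply Rinv_eq_reg, INR_eq in H. lia. }
  (* The shifts [c] lie strictly between 0 and 1 and are distinct, so that the functions are
     pairwise distinct even when the clopen sets repeat. *)
  set (f := fun k x =>
    indicator (fun z => ~ C (fst (of_nat k)) (snd (of_nat k)) z) x + c k).
  assert (Hfinj : forall i j, f i = f j -> i = j).
  { intros i j H. apply (f_equal (fun u => u x0)) in H. apply Hcinj.
    unfold f, indicator in H.
    pose proof (Hc i); pose proof (Hc j).
    repeat destruct excluded_middle_informative; lra. }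
  assert (Hpair : forall n i j, f (to_nat (n, i)) = f (to_nat (n, j)) -> i = j).
  { intros n i j H. apply Hfinj, to_nat_inj in H. congruence. }
  destruct (Ha (fun _ => 0) (fun n g => exists m, f (to_nat (n, m)) = g))
    as [B [HBA [HB [E [_ [_ [HEsurj HE]]]]]]].
  - intros V _. apply open_const.
  - intros n g [m <-]. apply continuous_indicator_plus, clopen_compl, HC.
  - intros n. exists (fun m => f (to_nat (n, m))). repeat split; eauto.
  - intros n. exists (fun m => f (to_nat (n, m))). repeat split; eauto.
    apply Cp_seq_converges_pointwise. intros x eps Heps.
    destruct (Hev n x) as [k Hk]. destruct (archimed_cor1 eps Heps) as [N [HN HN0]].
    exists (max k N). intros m Hm. unfold f. rewrite cancel_of_to. simpl.
    unfold indicator. destruct excluded_middle_informative as [Hno|_].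
    + destruct Hno. apply Hk. lia.
    + rewrite Rminus_0_r, Rplus_0_l, Rabs_pos_eq; [|apply Rlt_le, Hc].
      apply Rle_lt_trans with (/ INR N); trivial.
      apply Rinv_le_contravar; [now apply lt_0_INR|apply le_INR].
      assert (H := to_nat_non_decreasing n m). lia.
  - assert (Hh : forall n, exists h, forall m, (m >= h)%nat -> B n (f (to_nat (n, m)))).
    { intros n. destruct (injective_eventually_avoids _ (fun m => f (to_nat (n, m)))
                            (HB n) (Hpair n)) as [N HN].
      exists N. intros m Hm. apply NNPP. intros H. apply (HN m Hm). eauto. }
    destruct (fun_choice _ Hh) as [h Hh']. exists h. intros x.
    destruct (Cp_seq_converges_at E (fun _ => 0) x 1 HE) as [N HN]; [lra|].
    (* From index [N] on, the values of [E] at [x] are below 1, while [f] exceeds 1 at a point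
       outside its clopen set. By injectivity only finitely many codes name one of the first [N]
       terms of [E]. *)
    destruct (injective_eventually_avoids
                (fun g => exists k, (k < N)%nat /\ g = E k) f) as [M HM]; trivial.
    { exists (map E (seq 0 N)). intros g [k [Hk ->]]. apply in_map, in_seq. lia. }
    exists M. intros n m Hn Hm. apply NNPP. intros HnC.
    destruct (HEsurj (f (to_nat (n, m)))) as [k Hk].
    { exists n. now apply Hh'. }
    apply (HM (to_nat (n, m))).
    { assert (H := to_nat_non_decreasing n m). lia. }
    exists k. split; [|congruence].
    apply Nat.nle_gt. intros Hle. specialize (HN k Hle).
    rewrite Hk in HN. unfold f in HN. rewrite cancel_of_to in HN.
    cbn [fst snd] in HN.
    unfold indicator in HN. destruct excluded_middle_informative; [|tauto].
    apply Rabs_def2 in HN. specialize (Hc (to_nat (n, m))). lra.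
Qed.

(** * Pointwise limits of clopen sets *)

Definition clopen_limit (B : X -> Prop) : Prop :=
  exists D : nat -> X -> Prop, (forall k, clopen op (D k)) /\
    forall x, exists N, forall k, (k >= N)%nat -> (D k x <-> B x).

Lemma clopen_clopen_limit A : clopen op A -> clopen_limit A.
Proof.
  intros H. exists (fun _ => A). split; trivial.
  intros x. exists 0%nat. tauto.
Qed.

Lemma clopen_limit_compl B : clopen_limit B -> clopen_limit (fun x => ~ B x).
Proof.
  intros [D [HD Hlim]]. exists (fun k x => ~ D k x). split.
  - intros k. now apply clopen_compl.
  - intros x. destruct (Hlim x) as [N HN]. exists N. intros k Hk.
    specialize (HN k Hk). tauto.
Qed.

Lemma clopen_limit_union A B :
  clopen_limit A -> clopen_limit B -> clopen_limit (fun x => A x \/ B x).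
Proof.
  intros [D [HD Hlim]] [D' [HD' Hlim']]. exists (fun k x => D k x \/ D' k x). split.
  - intros k. now apply clopen_union.
  - intros x. destruct (Hlim x) as [N HN], (Hlim' x) as [N' HN'].
    exists (max N N'). intros k Hk.
    specialize (HN k ltac:(lia)). specialize (HN' k ltac:(lia)). tauto.
Qed.

Lemma clopen_limit_partial_union (A : nat -> X -> Prop) k :
  (forall n, clopen_limit (A n)) ->
  clopen_limit (fun x => exists i, (i <= k)%nat /\ A i x).
Proof.
  intros HA. induction k as [|k IH].
  - replace (fun x => exists i, (i <= 0)%nat /\ A i x) with (A 0%nat); trivial.
    apply pred_ext; intros x. split.
    + intros H. now exists 0%nat.
    + intros [i [Hi H]]. now replace 0%nat with i by lia.
  - replace (fun x => exists i, (i <= S k)%nat /\ A i x)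
      with (fun x => (exists i, (i <= k)%nat /\ A i x) \/ A (S k) x).
    + now apply clopen_limit_union.
    + apply pred_ext; intros x. split.
      * intros [[i [Hi H]]|H]; [exists i|exists (S k)]; auto.
      * intros [i [Hi H]]. destruct (Nat.eq_dec i (S k)) as [->|Hne]; auto.
        left. exists i. split; [lia|trivial].
Qed.

Lemma clopen_limit_diagonal (B : nat -> X -> Prop) :
  Cp_alpha1 op -> (forall n, clopen_limit (B n)) ->
  exists E : nat -> X -> Prop, (forall n, clopen op (E n)) /\
    forall x, exists N, forall n, (n >= N)%nat -> (E n x <-> B n x).
Proof.
  intros Ha HB. destruct (fun_choice _ HB) as [D HD].
  (* Agreement of [D n m] with the limit [B n] need not be a clopen condition; agreement of
     consecutive stages is. *)
  destruct (clopen_selection (fun n m x => D n m x <-> D n (S m) x)) as [h Hh]; trivial.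
  { intros n m. apply clopen_iff; apply HD. }
  { intros n x. destruct (HD n) as [_ Hlim]. destruct (Hlim x) as [N HN].
    exists N. intros m Hm.
    rewrite (HN m), (HN (S m)); [reflexivity|lia|lia]. }
  exists (fun n => D n (h n)). split.
  - intros n. apply HD.
  - intros x. destruct (Hh x) as [N HN]. exists N. intros n Hn.
    (* For [n >= N] the stages from [h n] on no longer change at [x], so stage [h n] already has the
       limiting value. *)
    assert (Hst : forall j, D n (h n) x <-> D n (h n + j)%nat x).
    { induction j as [|j IH].
      - now rewrite Nat.add_0_r.
      - rewrite IH, Nat.add_succ_r. apply HN; lia. }
    destruct (HD n) as [_ Hlim]. destruct (Hlim x) as [N' HN'].
    rewrite (Hst N'). apply HN'. lia.
Qed.

(** At each point the increasing partial unions eventually agree with the whole union, so a diagonal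
    sequence for them converges to it. *)
Lemma clopen_limit_countable_union (B : nat -> X -> Prop) :
  Cp_alpha1 op -> (forall n, clopen_limit (B n)) ->
  clopen_limit (fun x => exists n, B n x).
Proof.
  intros Ha HB.
  destruct (clopen_limit_diagonal (fun k x => exists i, (i <= k)%nat /\ B i x))
    as [E [HE Hlim]]; trivial.
  { intros k. now apply clopen_limit_partial_union. }
  exists E. split; trivial. intros x. destruct (Hlim x) as [N HN].
  destruct (classic (exists n, B n x)) as [[n Hn]|Hno].
  - exists (max N n). intros k Hk. rewrite HN by lia. split; [|intros _].
    + intros _. eauto.
    + exists n. split; [lia|trivial].
  - exists N. intros k Hk. rewrite HN by lia. split.
    + intros [i [_ Hi]]. eauto.
    + tauto.
Qed.

(** Induction on the generation of Borel sets. An open set is a countable union of clopen sets, each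
    the limit of a constant sequence. *)
Lemma borel_clopen_limit B :
  open_countable_union_clopen op -> Cp_alpha1 op -> borel op B -> clopen_limit B.
Proof.
  intros Hcl Ha HB. induction HB as [U HU|A _ IH|A _ IH].
  - destruct (Hcl U HU) as [C [HC HUC]].
    rewrite (pred_ext _ _ HUC). apply clopen_limit_countable_union; trivial.
    intros n. now apply clopen_clopen_limit.
  - now apply clopen_limit_compl.
  - now apply clopen_limit_countable_union.
Qed.

(** * From alpha_1 to bounded Borel images *)

Lemma alpha1_bounded_images :
  open_countable_union_clopen op -> Cp_alpha1 op -> borel_images_bounded op.
Proof.
  intros Hcl Ha Psi HPsi.
  (* Coding the pairs [(n, k)] by one index makes [E] correct at each point for all but finitely
     many pairs. *)
  destruct (clopen_limit_diagonal
    (fun i x => (Psi x (fst (of_nat i)) <= snd (of_nat i))%nat)) as [E [HE Hlim]]; trivial.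
  { intros i. apply borel_clopen_limit; trivial.
    apply (HPsi (fun f => (f (fst (of_nat i)) <= snd (of_nat i))%nat)).
    intros f Hf. exists (S (fst (of_nat i))). intros g Hg.
    rewrite Hg; [exact Hf|lia]. }
  destruct (clopen_selection (fun n k => E (to_nat (n, k)))) as [g Hg]; trivial.
  { intros n x. destruct (Hlim x) as [N HN]. exists (max N (Psi x n)).
    intros m Hm. apply HN.
    - assert (H := to_nat_non_decreasing n m). lia.
    - rewrite cancel_of_to. simpl. lia. }
  exists g. intros f [x <-].
  destruct (Hlim x) as [N HN], (Hg x) as [M HM].
  exists (max N M). intros n Hn.
  (* The code of [(n, g n)] is at least [n], so for large [n] the set [E] is correct there and
     membership yields [Psi x n <= g n]. *)
  assert (HEx : E (to_nat (n, g n)) x) by (apply HM; lia).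
  apply HN in HEx.
  - now rewrite cancel_of_to in HEx.
  - assert (Hle := to_nat_non_decreasing n (g n)). lia.
Qed.

End Topology.

Theorem mainTheorem14 (X : Type) (op : (X -> Prop) -> Prop)
  (Htop : is_topology op) (Hclopen : open_countable_union_clopen op) :
  (bounded_ideal_convergence_property op <-> Cp_alpha1 op) /\
  (Cp_alpha1 op <-> borel_images_bounded op).
Proof.
  assert (H12 := bounded_ideal_convergence_alpha1 X op Htop).
  assert (H23 := alpha1_bounded_images X op Htop Hclopen).
  assert (H31 := bounded_images_bounded_ideal_convergence X op Htop).
  tauto.
Qed.
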